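(* Let $\Gamma$ be a graded graph with levels $\Gamma_n$ and edge sets $D_n\subset\Gamma_n\times\Gamma_{n+1}$, $n=0,1,2,\dots$, and let $\tilde D_n\subset D_n$ be measurable subsets. Let $\tilde\Gamma$ be the subgraph of $\Gamma$ whose set of edges between levels $n$ and $n+1$ is $\tilde D_n$ for every $n$; thus the path space of $\tilde\Gamma$ is the set of all infinite paths $(v_0,v_1,\dots)$ of $\Gamma$ with $(v_n,v_{n+1})\in\tilde D_n$ for all $n\geqslant 0$. Let $\mu$ be a central probability measure on the path space of $\Gamma$, and assume that the path space of $\tilde\Gamma$ has positive $\mu$-measure. Then the restriction of $\mu$ to the path space of $\tilde\Gamma$ is a central measure (on the path space of $\tilde\Gamma$).
   Context: ''Graded graph'' means either of the following. (A) Continuous graph of Gelfand--Tsetlin type: the vertex set is $\bigsqcup_{n\ge 0}\Gamma_n$, where each level $\Gamma_n\subset\mathbb R^{d_n}$ is a closed convex polyhedral cone with nonempty interior. Vertices $x\in\Gamma_n$ and $y\in\Gamma_{n+1}$ are joined by an edge iff $(x,y)\in D_n$, where $D_n\subset\Gamma_n\times\Gamma_{n+1}$ is a closed convex polyhedral cone whose projections to $\Gamma_n$ and to $\Gamma_{n+1}$ are surjective. For all interior points $x\in\Gamma_n$, $z\in\Gamma_{n+1}$, the section $\{y\in\Gamma_{n+1}:(x,y)\in D_n\}$ is a convex polyhedral set of full dimension containing no lines, and the section $\{y\in\Gamma_n:(y,z)\in D_n\}$ is a convex polytope of full dimension. (B) Discrete graded graph: the levels $\Gamma_n$ are countable sets,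 $D_n\subset\Gamma_n\times\Gamma_{n+1}$ is the set of edges between consecutive levels, and every vertex is joined to only finitely many vertices. An infinite path is a sequence $(v_0,v_1,\dots)$ with $v_n\in\Gamma_n$ and $(v_n,v_{n+1})\in D_n$ for all $n\ge0$. The path space is the set of all infinite paths with the topology (and Borel structure) induced from $\prod_n\Gamma_n$. For $x\in\Gamma_n$, $\mathcal P(x)$ denotes the set of all finite paths $(v_0,\dots,v_{n-1},v_n)$ with $v_n=x$. Let $\mu_x$ be the normalized Lebesgue measure on $\mathcal P(x)$ in case (A) (for interior $x$ the set $\mathcal P(x)$ is a compact set of full dimension $d_0+\dots+d_{n-1}$ in the coordinates $(v_0,\dots,v_{n-1})$; for other $x$ the Lebesgue measure on its affine hull is used), and the uniform measure on the finite set $\mathcal P(x)$ in case (B). A nonzero finite Borel measure on the path space of $\Gamma$ is called central if, after normalization to a probability measure, for every $n\ge1$ the conditional distribution of the initial segment $(v_0,\dots,v_n)$ given the tail $(v_n,v_{n+1},\dots)$ is almost surely equal to $\mu_{v_n}$. For the subgraph $\tilde\Gamma$ the definition of a central measure is the same, with $\mathcal P(x)$ replaced by the set $\tilde{\mathcal P}(x)$ of finite paths in $\mathcal P(x)$ all of whose edges belong to the sets $\tilde D_i$, and with $\mu_x$ replaced by the normalized restriction of $\mu_x$ to $\tilde{\mathcal P}(x)$; the requirement includes that $\mu_{v_n}(\tilde{\mathcal P}(v_n))>0$ almost surely. *)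

(* Defs.v *)
From HB Require Import structures.
From mathcomp Require Import all_boot all_order all_algebra.
From mathcomp Require Import all_classical all_reals all_analysis.

Set Implicit Arguments.
Unset Strict Implicit.
Unset Printing Implicit Defensive.
Import Order.TTheory GRing.Theory Num.Theory.
Import numFieldNormedType.Exports.
Local Open Scope classical_set_scope.
Local Open Scope ring_scope.

Section Polyhedra.
Context {R : realType}.

Definition polyhedron n (S : set 'rV[R]_n) : Prop :=
  exists m (A : 'M[R]_(n, m)) (b : 'rV[R]_m),
    S = [set x | forall j, b 0 j <= (x *m A) 0 j].

(* Closed and convex by its form. *)
Definition polyhedral_cone n (S : set 'rV[R]_n) : Prop :=
  exists m (A : 'M[R]_(n, m)), S = [set x | forall j, 0 <= (x *m A) 0 j].

Definition polytope n (S : set 'rV[R]_n) : Prop :=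
  polyhedron S /\ bounded_set S.

Definition affine_hull n (S : set 'rV[R]_n) : set 'rV[R]_n :=
  [set y | exists m (c : 'I_m -> R) (x : 'I_m -> 'rV[R]_n),
     [/\ \sum_i c i = 1, forall i, S (x i) & y = \sum_i c i *: x i]].

Definition full_dimensional n (S : set 'rV[R]_n) : Prop :=
  affine_hull S = [set: 'rV[R]_n].

Definition contains_line n (S : set 'rV[R]_n) : Prop :=
  exists p u : 'rV[R]_n, u != 0 /\ forall t : R, S (p + t *: u).

End Polyhedra.

Section Lebesgue.
Context {R : realType}.

(* The k-fold product of [lebesgue_measure], as the iterated integral to which
   the product measure of the library unfolds; meant for Borel sets. *)
Fixpoint lebesgue_rV (k : nat) : set 'rV[R]_k -> \bar R :=
  match k return set 'rV[R]_k -> \bar R with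
  | 0%N => fun A => (\1_A 0)%:E
  | k'.+1 => fun A =>
      (\int[@lebesgue_measure R]_x
        lebesgue_rV [set v : 'rV[R]_k' |
                      A (row_mx (x%:M : 'rV[R]_1) v : 'rV[R]_(1 + k'))])%E
  end.

(* [existT _ k (a, Q)] stands for the map t |-> a + t *m Q, which is required
   to be an isometry of R^k onto the affine hull of [S]. *)
Definition affine_frame N (S : set 'rV[R]_N)
    (f : {k : nat & ('rV[R]_N * 'M[R]_(k, N))%type}) : Prop :=
  let Q := (tagged f).2 in
  Q *m Q^T = 1%:M /\
  affine_hull S = range (fun t : 'rV[R]_(tag f) => (tagged f).1 + t *m Q).

(* Lebesgue measure of the affine hull of [S]. By invariance of the Lebesgue
   measure of R^k under isometries, its values on Borel sets do not depend on
   the chosen frame, and are those of [lebesgue_rV] when the affine hull is the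
   whole space. The default frame is only used for an empty [S]. *)
Definition hull_lebesgue N (S : set 'rV[R]_N) (A : set 'rV[R]_N) : \bar R :=
  let f := xget (Tagged (fun k => ('rV[R]_N * 'M[R]_(k, N))%type)
                   (0 : 'rV[R]_N, 0 : 'M[R]_(0, N)))
                (affine_frame S) in
  lebesgue_rV [set t : 'rV[R]_(tag f) | A ((tagged f).1 + t *m (tagged f).2)].

Definition normalized (S : Type) (m : set S -> \bar R) (K A : set S) : \bar R :=
  (m (A `&` K) / m K)%E.

End Lebesgue.

Definition borel_set (U : topologicalType) (A : set U) : Prop :=
  <<s @open U >> A.

(* Borel sigma-algebra of the product topology. *)
Definition borel_prod (I : Type) (U : I -> ptopologicalType) :=
  g_sigma_algebraType (@open (prod_topology U)).

Definition discrete_space (T : pointedType) : ptopologicalType :=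
  HB.pack (discrete_topology T) (Pointed.on (discrete_topology T))
    (Topological.on (discrete_topology T)).

Section Paths.
Variable T : nat -> ptopologicalType.

Definition vertex_sequence := borel_prod T.
Definition segment (n : nat) := borel_prod (fun i : 'I_n.+1 => T i).
Definition tail (n : nat) := borel_prod (fun k : nat => T (k + n)%N).

Definition segment_upto n (v : vertex_sequence) : segment n := fun i => v i.
Definition tail_from n (v : vertex_sequence) : tail n := fun k => v (k + n)%N.

Variable V : forall n, set (T n).
Variable E : forall n, set (T n * T n.+1).

Definition infinite_paths : set vertex_sequence :=
  [set v : forall n, T n |
    (forall n, V (v n)) /\ forall n, E (v n, v n.+1)].

Definition finite_paths n (x : T n) : set (segment n) :=
  [set s : forall i : 'I_n.+1, T i |
    [/\ forall i, V (s i),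
        forall i : 'I_n, E (s (widen_ord (leqnSn n) i), s (lift ord0 i)) &
        s ord_max = x]].

End Paths.

Section ContinuousGraph.
Context {R : realType}.

Unset Implicit Arguments.
Record continuous_graph := ContinuousGraph {
  cg_dim : nat -> nat;
  cg_vertex : forall n, set 'rV[R]_(cg_dim n);
  cg_edge : forall n, set ('rV[R]_(cg_dim n) * 'rV[R]_(cg_dim n.+1));
  _ : forall n, polyhedral_cone (cg_vertex n);
  _ : forall n, (cg_vertex n)° !=set0;
  _ : forall n, cg_edge n `<=` cg_vertex n `*` cg_vertex n.+1;
  _ : forall n, polyhedral_cone
        [set w : 'rV[R]_(cg_dim n + cg_dim n.+1) |
          cg_edge n (lsubmx w, rsubmx w)];
  _ : forall n, fst @` cg_edge n = cg_vertex n;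
  _ : forall n, snd @` cg_edge n = cg_vertex n.+1;
  _ : forall n x, (cg_vertex n)° x ->
        let S := [set y | cg_edge n (x, y)] in
        [/\ polyhedron S, full_dimensional S & ~ contains_line S];
  _ : forall n z, (cg_vertex n.+1)° z ->
        let S := [set y | cg_edge n (y, z)] in
        polytope S /\ full_dimensional S
}.

Set Implicit Arguments.

Variable G : continuous_graph.

Definition cg_level (n : nat) : ptopologicalType := 'rV[R]_(cg_dim G n).

Definition cg_paths n (x : cg_level n) : set (segment cg_level n) :=
  @finite_paths cg_level (cg_vertex G) (cg_edge G) n x.

(* The coordinates (v_0, ..., v_(n-1)) of a segment (v_0, ..., v_n). *)
Definition cg_coord n (s : segment cg_level n) :
    'rV[R]_(\sum_(i < n) cg_dim G i) :=
  \mxrow_(i < n) (s (widen_ord (leqnSn n) i) : 'rV[R]_(cg_dim G i)).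

Definition cg_unif n (x : cg_level n) (B : set (segment cg_level n)) : \bar R :=
  let K := @cg_coord n @` cg_paths x in
  normalized (hull_lebesgue K) K (@cg_coord n @` (B `&` cg_paths x)).

End ContinuousGraph.

Arguments continuous_graph R : clear implicits.

Unset Implicit Arguments.
(* Levels are countable subsets of ambient discrete spaces, so that they may be
   empty although ambient types are pointed. *)
Record discrete_graph := DiscreteGraph {
  dg_type : nat -> pointedType;
  dg_vertex : forall n, set (dg_type n);
  dg_edge : forall n, set (dg_type n * dg_type n.+1);
  _ : forall n, countable (dg_vertex n);
  _ : forall n, dg_edge n `<=` dg_vertex n `*` dg_vertex n.+1;
  _ : forall n x, dg_vertex n x -> finite_set [set y | dg_edge n (x, y)];
  _ : forall n z, dg_vertex n.+1 z -> finite_set [set y | dg_edge n (y, z)]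
}.

Set Implicit Arguments.

Section DiscreteGraph.
Context {R : realType}.
Variable G : discrete_graph.

Definition dg_level (n : nat) : ptopologicalType :=
  discrete_space (dg_type G n).

Definition dg_paths n (x : dg_level n) : set (segment dg_level n) :=
  @finite_paths dg_level (dg_vertex G) (dg_edge G) n x.

Definition dg_unif n (x : dg_level n) (B : set (segment dg_level n)) : \bar R :=
  normalized (@counting (segment dg_level n) R) (dg_paths x) B.

End DiscreteGraph.

Variant graded_graph (R : realType) :=
  | Continuous of continuous_graph R
  | Discrete of discrete_graph.

Section GradedGraph.
Context {R : realType}.

Definition level (G : graded_graph R) : nat -> ptopologicalType :=
  match G with
  | Continuous C => cg_level C
  | Discrete D => dg_level D
  end.

Definition vertices (G : graded_graph R) : forall n, set (level G n) :=
  match G with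
  | Continuous C => cg_vertex C
  | Discrete D => dg_vertex D
  end.

Definition edges (G : graded_graph R) :
    forall n, set (level G n * level G n.+1) :=
  match G with
  | Continuous C => cg_edge C
  | Discrete D => dg_edge D
  end.

Definition path_measure (G : graded_graph R) :
    forall n, level G n -> set (segment (level G) n) -> \bar R :=
  match G with
  | Continuous C => @cg_unif R C
  | Discrete D => @dg_unif R D
  end.

Arguments vertices : clear implicits.
Arguments edges : clear implicits.
Arguments path_measure : clear implicits.

Variable G : graded_graph R.

Definition path_space : set (vertex_sequence (level G)) :=
  infinite_paths (vertices G) (edges G).

End GradedGraph.

Arguments vertices {R} G n _.
Arguments edges {R} G n _.
Arguments path_measure {R} G n x B.
Arguments path_space {R} G _.

Section Central.
Context {R : realType} {T : nat -> ptopologicalType}.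
Local Open Scope ereal_scope.

Definition regular_conditional_distribution
    (P : probability (vertex_sequence T) R) n
    (kappa : R.-pker (tail T n) ~> (segment T n)) : Prop :=
  forall (B : set (segment T n)) (C : set (tail T n)),
    measurable B -> measurable C ->
    P (@segment_upto T n @^-1` B `&` @tail_from T n @^-1` C) =
    \int[P]_(v in @tail_from T n @^-1` C) kappa (tail_from n v) B.

(* No measurability of [rho] is presupposed: it is required to agree almost
   surely with a regular conditional distribution of (v_0, ..., v_n) given
   (v_n, v_(n+1), ...). *)
Definition conditioned_by (P : probability (vertex_sequence T) R)
    (rho : forall n, T n -> set (segment T n) -> \bar R) : Prop :=
  forall n, (0 < n)%N ->
  exists kappa : R.-pker (tail T n) ~> (segment T n),
    regular_conditional_distribution P kappa /\
    {ae P, forall v : vertex_sequence T,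
       forall B : set (segment T n), measurable B ->
         kappa (tail_from n v) B = rho n (v n) B}.

(* For a nonzero finite measure the second argument of [mnormalize] is not
   used. *)
Definition normalize (m : {measure set (vertex_sequence T) -> \bar R}) :
    probability (vertex_sequence T) R :=
  mnormalize m (\d_ (point : vertex_sequence T)).

Definition nonzero_finite_on (X : set (vertex_sequence T))
    (m : {measure set (vertex_sequence T) -> \bar R}) : Prop :=
  [/\ 0 < m setT, m setT < +oo & m (~` X) = 0].

End Central.

Section CentralMeasures.
Context {R : realType} (G : graded_graph R).
Local Open Scope ereal_scope.

(* A measure on a path space is encoded as a measure on the ambient product of
   the levels that is concentrated on the path space. *)
Definition central
    (m : {measure set (vertex_sequence (level G)) -> \bar R}) : Prop :=
  nonzero_finite_on (path_space G) m /\
  conditioned_by (normalize m) (path_measure G).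

Variable E' : forall n, set (level G n * level G n.+1).

Definition subgraph_path_space : set (vertex_sequence (level G)) :=
  [set v : forall n, level G n | path_space G v /\
    forall n, E' (v n, v n.+1)].

Definition subgraph_paths n (x : level G n) : set (segment (level G) n) :=
  [set s | finite_paths (vertices G) (edges G) x s /\
           finite_paths (vertices G) E' x s].

Definition subgraph_path_measure n (x : level G n) :
    set (segment (level G) n) -> \bar R :=
  normalized (path_measure G n x) (subgraph_paths x).

Definition subgraph_central
    (m : {measure set (vertex_sequence (level G)) -> \bar R}) : Prop :=
  [/\ nonzero_finite_on subgraph_path_space m,
      forall n, (0 < n)%N ->
        {ae normalize m, forall v : vertex_sequence (level G),
           0 < path_measure G n (v n) (subgraph_paths (v n))} &
      conditioned_by (normalize m) subgraph_path_measure].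

End CentralMeasures.

Arguments subgraph_path_space {R} G E' _.
Arguments subgraph_central {R} G E' m.

Lemma measurable_prod_pair (T : nat -> ptopologicalType) n
    (A : set (T n * T n.+1)) : borel_set A ->
  measurable ([set v : forall n, T n | A (v n, v n.+1)] :
    set (vertex_sequence T)).
Proof.
move=> mA.
pose f : prod_topology T -> T n * T n.+1 := fun v => (v n, v n.+1).
have cf : continuous f.
  move=> v; apply: cvg_pair; exact: (@proj_continuous _ T).
suff: sigma_algebra setT [set B | <<s @open (prod_topology T) >> (f @^-1` B)].
  move=> sB; apply: (mA _ (conj sB _)) => B oB.
  by apply: sub_sigma_algebra; move/continuousP: cf; exact.
split => /=.
- by rewrite preimage_set0; exact: sigma_algebra0.
- move=> B mB; rewrite setTD preimage_setC -setTD; exact: sigma_algebraCD.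
- move=> F mF; rewrite preimage_bigcup; exact: sigma_algebra_bigcup.
Qed.

Lemma edges_vertices (R : realType) (G : graded_graph R) n :
  edges G n `<=` vertices G n `*` vertices G n.+1.
Proof. by case: G => [[? ? ? ? ? sub *]|[? ? ? ? sub *]]; exact: sub. Qed.

Lemma measurable_subgraph_path_space (R : realType) (G : graded_graph R)
    (E' : forall n, set (level G n * level G n.+1)) :
  (forall n, E' n `<=` edges G n) -> (forall n, borel_set (E' n)) ->
  measurable (subgraph_path_space G E').
Proof.
move=> sub mE'.
have -> : subgraph_path_space G E' = \bigcap_n
    [set v : forall n, level G n | E' n (v n, v n.+1)].
  apply/seteqP; split=> [v [_ vE'] n _ //=|v vE'] /=.
  split; last by move=> n; exact: vE'.
  split=> n; last exact/sub/vE'.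
  have := @edges_vertices _ _ _ _ (sub _ _ (vE' n Logic.I)).
  by move=> [/= h _]; exact: h.
apply: bigcapT_measurable => n.
exact: (@measurable_prod_pair (level G) n _ (mE' n)).
Qed.

(* Main.v *)
Require Import Defs.
From HB Require Import structures.
From mathcomp Require Import all_boot all_order all_algebra.
From mathcomp Require Import all_classical all_reals all_analysis.
From mathcomp Require Import measurable_realfun.

(** Fix n >= 1 and cut a path at level n into its initial segment
    (v_0, ..., v_n) and its tail t = (v_n, v_(n+1), ...). Lying in the subgraph
    is the conjunction of a condition on the segment (its n edges are retained:
    [edges_upto]) and a condition on the tail (all its edges are retained:
    [edges_from]), see [subgraph_path_spaceE]. Restricting to an event of this
    product form is harmless for conditional distributions: the tail condition
    is decided by the conditioning variable, and the segment condition W turns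
    the conditional law k(t, .) of the segment into k(t, . `&` W) / k(t, W). The
    abstract form of this fact is [conditioned_disintegrates]. Moreover
    k(t, W) > 0 for almost every tail of a path in the subgraph, because the
    tails with k(t, W) = 0 extend to segments in W with probability zero
    [conditioned_kernel_null].

    For a central measure, k(t, .) is almost surely the measure mu_x on the
    finite paths ending at x = v_n. It is concentrated on those paths
    [path_measure_eq0], and among them the segments in W are exactly the paths
    of the subgraph [subgraph_pathsE]. So k(t, W) is the mu_x-measure of the
    set of subgraph paths ending at x, which is therefore positive, and the
    conditioned kernel is the normalized restriction of mu_x to that set. *)

Import Order.TTheory GRing.Theory Num.Theory.

Set Implicit Arguments.
Unset Strict Implicit.
Unset Printing Implicit Defensive.

Local Open Scope classical_set_scope.
Local Open Scope ring_scope.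
Local Open Scope ereal_scope.

(** * Change of measure and conditioned kernels *)

Section density.
Import HBNNSimple.
Context d (T : measurableType d) (R : realType).
Variables (mu nu : {measure set T -> \bar R}) (w : T -> \bar R).
Hypotheses (mw : measurable_fun setT w) (w0 : forall x, 0 <= w x)
  (wfin : forall x, w x \is a fin_num).
Hypothesis nuE : forall A, measurable A -> nu A = \int[mu]_(x in A) w x.

Let integral_density_nnsfun (h : {nnsfun T >-> R}) :
  \int[nu]_x (h x)%:E = \int[mu]_x (w x * (h x)%:E).
Proof.
have mfib r : measurable (h @^-1` [set r]) by [].
under eq_integral do rewrite fimfunE -fsumEFin//.
rewrite ge0_integral_fsum//; last 2 first.
  - by move=> r; exact/measurable_EFinP/measurableT_comp.
  - by move=> r x _; rewrite EFinM nnfun_muleindic_ge0.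
under [RHS]eq_integral.
  move=> x _; rewrite fimfunE -fsumEFin// ge0_mule_fsumr; last first.
    by move=> r; rewrite EFinM nnfun_muleindic_ge0.
  over.
rewrite [RHS]ge0_integral_fsum//; last 2 first.
  - move=> r; apply: emeasurable_funM => //.
    exact/measurable_EFinP/measurableT_comp.
  - by move=> r x _; rewrite mule_ge0// EFinM nnfun_muleindic_ge0.
apply: eq_fsbigr => r; rewrite inE => -[x _ hx].
have r0 : 0 <= r%:E by rewrite -hx lee_fin.
under eq_integral do rewrite EFinM.
rewrite ge0_integralZl//; last exact/measurable_EFinP.
rewrite integral_indic// setIT nuE//.
under [RHS]eq_integral do rewrite EFinM muleCA.
rewrite ge0_integralZl//; last 2 first.
  - by apply: emeasurable_funM => //; exact/measurable_EFinP.
  - by move=> y _; rewrite mule_ge0// lee_fin.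
congr (_ * _); rewrite integral_mkcond; apply: eq_integral => y _.
by rewrite epatch_indic.
Qed.

(** The set function identity [nuE] extends to integrals by monotone
    approximation with simple functions. Finiteness of the density lets the
    product pass to the limit. *)
Lemma ge0_integral_density D (f : T -> \bar R) : measurable D ->
  measurable_fun D f -> (forall x, D x -> 0 <= f x) ->
  \int[nu]_(x in D) f x = \int[mu]_(x in D) (w x * f x).
Proof.
move=> mD mf f0; rewrite integral_mkcond [RHS]integral_mkcond.
have mg : measurable_fun setT (f \_ D) by apply/(measurable_restrictT f mD).
have g0 x : 0 <= (f \_ D) x by rewrite erestrict_ge0.
have -> : (fun x => w x * f x) \_ D = (fun x => w x * (f \_ D) x).
  by apply/funext => x; rewrite /patch; case: ifPn => // _; rewrite mule0.
pose g_ := nnsfun_approx measurableT mg.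
have gE x : (f \_ D) x = limn (fun n => (g_ n x)%:E).
  by apply/esym/cvg_lim => //; exact: cvg_nnsfun_approx.
transitivity (limn (fun n => \int[nu]_x (g_ n x)%:E)).
  rewrite -monotone_convergence//.
  - exact: eq_integral.
  - by move=> n; exact/measurable_EFinP.
  - by move=> n x _; rewrite lee_fin.
  - by move=> x _ a b ab; rewrite lee_fin; exact/lefP/nd_nnsfun_approx.
under eq_fun do rewrite integral_density_nnsfun.
rewrite -monotone_convergence//.
- apply: eq_integral => x _; rewrite gE limeMl//.
  apply: ereal_nondecreasing_is_cvgn => a b ab.
  by rewrite lee_fin; exact/lefP/nd_nnsfun_approx.
- by move=> n; apply: emeasurable_funM => //; exact/measurable_EFinP.
- by move=> n x _; rewrite mule_ge0// lee_fin.
- move=> x _ a b ab; rewrite lee_wpmul2l// lee_fin.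
  exact/lefP/nd_nnsfun_approx.
Qed.

End density.

Section krestrict.
Context d d' (X : measurableType d) (Y : measurableType d') (R : realType).
Variables (k : R.-ker X ~> Y) (W : set Y) (mW : measurable W).

Definition krestrict (x : X) : {measure set Y -> \bar R} := mrestr (k x) mW.

Let measurable_krestrict U :
  measurable U -> measurable_fun [set: X] (krestrict ^~ U).
Proof.
by move=> mU; apply: (measurable_kernel k); exact: measurableI.
Qed.

HB.instance Definition _ :=
  isKernel.Build _ _ _ _ _ krestrict measurable_krestrict.

End krestrict.

Section prob_kernel_conditioning.
Context d d' (X : measurableType d) (Y : measurableType d') (R : realType).
Variables (k : R.-pker X ~> Y) (W : set Y) (mW : measurable W).

Lemma prob_kernel_le (x : X) (A B : set Y) : measurable A -> measurable B ->
  A `<=` B -> k x A <= k x B.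
Proof. by move=> mA mB AB; rewrite le_measure ?inE. Qed.

Lemma prob_kernel_fin_num (x : X) (B : set Y) :
  measurable B -> k x B \is a fin_num.
Proof.
move=> mB; rewrite ge0_fin_numE//.
by rewrite (le_lt_trans (prob_kernel_le x mB measurableT _))// prob_kernel ltry.
Qed.

Lemma knormalize_krestrictE (D : probability Y R) (x : X) (B : set Y) :
  k x W != 0 ->
  knormalize (krestrict k mW) D x B = k x (B `&` W) / k x W.
Proof.
move=> kW0; have kW := prob_kernel_fin_num x mW.
rewrite /knormalize /= /mnormalize /= /mrestr setTI ifF; last first.
  by apply/negbTE; rewrite negb_or kW0; move: kW; rewrite fin_numE => /andP[].
by rewrite -[in RHS](fineK kW) inver fine_eq0// (negbTE kW0).
Qed.

End prob_kernel_conditioning.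

(** * Conditioning a disintegration on a product event *)

Section conditioning.
Context d1 d2 d3 (X : measurableType d1) (S : measurableType d2)
  (T : measurableType d3) (R : realType).
Variables (f : X -> S) (g : X -> T).
Hypotheses (mf : measurable_fun setT f) (mg : measurable_fun setT g).

(** [k] is a regular conditional law of [f] given [g]. *)
Definition disintegrates (P : probability X R) (k : R.-ker T ~> S) :=
  forall B C, measurable B -> measurable C ->
    P (f @^-1` B `&` g @^-1` C) = \int[P]_(x in g @^-1` C) k (g x) B.

Variables (P Q : probability X R) (k : R.-pker T ~> S).
Variables (W : set S) (mW : measurable W) (C0 : set T) (mC0 : measurable C0).
Variable c : R.
Hypothesis c0 : (0 <= c)%R.
Hypothesis QE : forall A, measurable A ->
  Q A = P (A `&` (f @^-1` W `&` g @^-1` C0)) * c%:E.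
Hypothesis Pk : disintegrates P k.

Let mpre_f B : measurable B -> measurable (f @^-1` B).
Proof. by move=> mB; rewrite -[_ @^-1` _]setTI; exact: mf. Qed.

Let mpre_g C : measurable C -> measurable (g @^-1` C).
Proof. by move=> mC; rewrite -[_ @^-1` _]setTI; exact: mg. Qed.

Let QfgE B C : measurable B -> measurable C ->
  Q (f @^-1` B `&` g @^-1` C) =
  \int[P]_(x in g @^-1` (C `&` C0)) (c%:E * k (g x) (B `&` W)).
Proof.
move=> mB mC; rewrite QE; last first.
  by apply: measurableI; [exact: mpre_f|exact: mpre_g].
have -> : f @^-1` B `&` g @^-1` C `&` (f @^-1` W `&` g @^-1` C0) =
    f @^-1` (B `&` W) `&` g @^-1` (C `&` C0) by rewrite !preimage_setI setIACA.
rewrite Pk; [|exact: measurableI..].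
rewrite muleC ge0_integralZl//.
- by apply: mpre_g; exact: measurableI.
- apply: (measurable_funS measurableT) => //.
  apply: (measurableT_comp (f := k ^~ (B `&` W))) => //.
  by apply: measurable_kernel; exact: measurableI.
Qed.

(** Given [g x = t] with [k t W = 0], the event [f @^-1` W] has conditional
    probability zero under [P], and [Q] charges no set outside that event. *)
Lemma conditioned_kernel_null :
  Q (g @^-1` [set t | k t W = 0]) = 0.
Proof.
have mZ : measurable [set t | k t W = 0].
  rewrite -[X in measurable X]setTI.
  exact: (measurable_kernel k W mW measurableT [set 0]).
rewrite -[X in Q X]setTI -(preimage_setT f) QfgE// setTI.
by apply: integral0_eq => x [/= -> _]; rewrite mule0.
Qed.

(** The law of [g] under [Q] has density [c * k t W] on [C0] with respect to its
    law under [P]. This factor cancels the denominator of the conditioned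
    kernel, and what is left is the disintegration of [P] over [B `&` W]. The
    law [D] only fills in the kernel where [k t W = 0], and there the density
    vanishes. *)
Lemma conditioned_disintegrates (D : probability S R) :
  disintegrates Q (knormalize (krestrict k mW) D).
Proof.
set k' := knormalize _ _.
move=> B C mB mC.
have mk B' : measurable B' -> measurable_fun setT (k ^~ B').
  by move=> mB'; exact: measurable_kernel.
have mk' : measurable_fun setT (k' ^~ B) by exact: measurable_kernel.
pose w := (fun t => c%:E * k t W) \_ C0.
have mw : measurable_fun setT w.
  apply/(measurable_restrictT _ mC0); apply: measurable_funTS.
  by apply: emeasurable_funM => //; exact: mk.
have w0 t : 0 <= w t.
  by apply: erestrict_ge0 => ? _; rewrite mule_ge0.
have wfin t : w t \is a fin_num.
  rewrite /w /patch; case: ifP => // _.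
  by rewrite fin_numM// prob_kernel_fin_num.
have dens A : measurable A ->
    pushforward Q g A = \int[pushforward P g]_(t in A) w t.
  move=> mA; rewrite /pushforward /= -[X in Q X]setTI -(preimage_setT f) QfgE//.
  rewrite setTI ge0_integral_pushforward//; last exact: measurable_funTS.
  rewrite preimage_setI integral_mkcondr; apply: eq_integral => x _.
  by rewrite /w /patch.
transitivity (\int[pushforward Q g]_(t in C) k' t B); last first.
  by rewrite ge0_integral_pushforward//; exact: measurable_funTS.
rewrite (ge0_integral_density mw w0 wfin dens)//; last exact: measurable_funTS.
rewrite ge0_integral_pushforward//; last 2 first.
- apply: measurable_funTS; exact: emeasurable_funM.
- by move=> t _; rewrite mule_ge0.
rewrite QfgE// preimage_setI integral_mkcondr; apply: eq_integral => x _.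
rewrite /w /patch /= -[_ \in g @^-1` C0]/(g x \in C0).
case: ifPn => _; last by rewrite mul0e.
rewrite -muleA; congr (_ * _).
have [kW0|kW0] := eqVneq (k (g x) W) 0.
  rewrite kW0 mul0e; apply/eqP; rewrite eq_le measure_ge0 andbT -kW0.
  by apply: prob_kernel_le => //; exact: measurableI.
rewrite /k' knormalize_krestrictE// muleCA divee ?mule1//.
exact: prob_kernel_fin_num.
Qed.

End conditioning.

(** * Measurability in path spaces *)

Lemma borel_set_preimage (X Y : topologicalType) (f : X -> Y) (A : set Y) :
  continuous f -> borel_set A -> borel_set (f @^-1` A).
Proof.
move=> cf mA.
suff sB : sigma_algebra setT [set B | borel_set (f @^-1` B)].
  apply: (mA _ (conj sB _)) => B oB.
  by apply: sub_sigma_algebra; move/continuousP: cf; exact.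
split=> /=.
- by rewrite preimage_set0; exact: sigma_algebra0.
- by move=> B mB; rewrite setTD preimage_setC -setTD; exact: sigma_algebraCD.
- by move=> F mF; rewrite preimage_bigcup; exact: sigma_algebra_bigcup.
Qed.

Lemma continuous_prod (X : topologicalType) (I : Type)
    (U : I -> topologicalType) (f : X -> prod_topology U) :
  (forall i, continuous (fun x => f x i)) -> continuous f.
Proof.
move=> cf x; apply/cvg_sup => i.
apply/(@continuous_comp_initial _ X (U i) (fun g => g i) f).
exact: cf.
Qed.

Lemma measurable_segment_upto (T : nat -> ptopologicalType) n :
  measurable_fun setT (@segment_upto T n).
Proof.
move=> _ B mB; rewrite setTI.
apply: (@borel_set_preimage (prod_topology T)
  (prod_topology (fun i : 'I_n.+1 => T i))) => //.
by apply: continuous_prod => i; exact: (@proj_continuous _ T).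
Qed.

Lemma measurable_tail_from (T : nat -> ptopologicalType) n :
  measurable_fun setT (@tail_from T n).
Proof.
move=> _ B mB; rewrite setTI.
apply: (@borel_set_preimage (prod_topology T)
  (prod_topology (fun k : nat => T (k + n)%N))) => //.
by apply: continuous_prod => i; exact: (@proj_continuous _ T).
Qed.

(** Makes the set of segments that end at a given vertex measurable. *)
Lemma closed_level1 (R : realType) (G : graded_graph R) n (x : level G n) :
  closed [set x].
Proof.
apply: accessible_closed_set1; apply: hausdorff_accessible.
case: G x => [C|D] x /=.
  have := @norm_hausdorff R ('rV[R]_(cg_dim C n)).
  exact.
exact: (@discrete_hausdorff (dg_level D n)).
Qed.

(** As [E i] lives on levels i and i+1 while a segment is indexed by 'I_n.+1,
    the endpoints of edge [i : 'I_n] are indexed by [widen_ord] and [lift],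
    whose underlying naturals compute to i and i+1. *)
Definition edges_upto {T : nat -> ptopologicalType}
    (E : forall n, set (T n * T n.+1)) n : set (segment T n) :=
  [set s : forall i : 'I_n.+1, T i | forall i : 'I_n,
    E i (s (widen_ord (leqnSn n) i), s (lift ord0 i))].

Definition edges_from {T : nat -> ptopologicalType}
    (E : forall n, set (T n * T n.+1)) n : set (tail T n) :=
  [set t : forall k, T (k + n)%N | forall k, E (k + n)%N (t k, t k.+1)].

Arguments edges_upto {T} E n _.
Arguments edges_from {T} E n _.

Lemma measurable_edges_upto (T : nat -> ptopologicalType)
    (E : forall n, set (T n * T n.+1)) n :
  (forall k, borel_set (E k)) -> measurable (edges_upto E n).
Proof.
move=> mE.
have -> : edges_upto E n = \bigcap_(i in [set: 'I_n])
   [set s : forall i : 'I_n.+1, T i |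
     E i (s (widen_ord (leqnSn n) i), s (lift ord0 i))].
  by apply/seteqP; split=> [s Es i _|s Es i]; apply: Es.
apply: fin_bigcap_measurable => // i _.
apply: (@borel_set_preimage (prod_topology (fun i : 'I_n.+1 => T i)) _
  (fun s => (s (widen_ord (leqnSn n) i), s (lift ord0 i))) _ _ (mE i)).
move=> s; apply: cvg_pair; exact: (@proj_continuous _ (fun i : 'I_n.+1 => T i)).
Qed.

Lemma measurable_edges_from (T : nat -> ptopologicalType)
    (E : forall n, set (T n * T n.+1)) n :
  (forall k, borel_set (E k)) -> measurable (edges_from E n).
Proof.
move=> mE.
have -> : edges_from E n = \bigcap_k
   [set t : forall k, T (k + n)%N | E (k + n)%N (t k, t k.+1)].
  by apply/seteqP; split=> [s Es i _|s Es i]; apply: Es.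
apply: bigcapT_measurable => k.
apply: (@borel_set_preimage (prod_topology (fun k => T (k + n)%N)) _
  (fun t => (t k, t k.+1)) _ _ (mE (k + n)%N)).
move=> s; apply: cvg_pair; exact: (@proj_continuous _ (fun k => T (k + n)%N)).
Qed.

(** * Paths of the graph and of the subgraph *)

Lemma lebesgue_rV0 (R : realType) k : @lebesgue_rV R k set0 = 0.
Proof.
elim: k => [|k IH] /=; first by rewrite indic0.
by apply: integral0_eq => x _; exact: IH.
Qed.

(** In both cases the measure of a set of segments is computed from its
    intersection with the finite paths ending at [x]. *)
Lemma path_measure_eq0 (R : realType) (G : graded_graph R) n (x : level G n)
    (B : set (segment (level G) n)) :
  B `&` finite_paths (vertices G) (edges G) x = set0 ->
  path_measure G n x B = 0.
Proof.
case: G x B => [C|D] x B /= B0; rewrite /cg_unif /dg_unif /normalized.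
  rewrite /cg_paths B0 image_set0 set0I.
  by rewrite [X in X / _](_ : _ = 0) ?mul0e//; exact: lebesgue_rV0.
by rewrite /dg_paths B0 measure0 mul0e.
Qed.

Section subgraph.
Context {R : realType} (G : graded_graph R).
Variable E' : forall n, set (level G n * level G n.+1).
Arguments E' : clear implicits.
Hypothesis subE : forall n, E' n `<=` edges G n.

Lemma subgraph_path_spaceE n : subgraph_path_space G E' =
  @segment_upto (level G) n @^-1` edges_upto E' n `&`
  @tail_from (level G) n @^-1` edges_from E' n.
Proof.
apply/seteqP; split=> [v [_ vE']|v [/= vW vC]].
  by split=> [i|k]; exact: vE'.
have vE' k : E' k (v k, v k.+1).
  have [kn|nk] := ltnP k n; first exact: (vW (Ordinal kn)).
  have : E' (k - n + n)%N (v (k - n + n)%N, v (k - n + n).+1%N) := vC (k - n)%N.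
  by rewrite subnK.
split=> //; split=> k; last exact/subE.
by have [] := edges_vertices (subE (vE' k)).
Qed.

(** For n >= 1 every vertex of a segment is an endpoint of one of its edges, so
    retained edges alone force all vertices into the graph. *)
Lemma subgraph_pathsE n (x : level G n) : (0 < n)%N ->
  subgraph_paths E' x =
  edges_upto E' n `&` [set s : forall i : 'I_n.+1, level G i | s ord_max = x].
Proof.
move=> n0; apply/seteqP; split=> [s [_ [_ sE' sx]]//|s [sE' sx]].
have sE i : edges G _ (s (widen_ord (leqnSn n) i), s (lift ord0 i)).
  exact/subE/sE'.
have sV (i : 'I_n.+1) : vertices G i (s i).
  case: (unliftP ord0 i) => [j ->|->].
    by have [] := edges_vertices (sE j).
  (* Vertex 0 is the source of the first edge; all others are targets. *)
  case: n n0 x s sE' sx sE i => // n _ x s _ _ sE _.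
  have -> : ord0 = widen_ord (leqnSn n.+1) ord0 by exact/val_inj.
  by have [] := edges_vertices (sE ord0).
by split; split.
Qed.

Lemma measurable_subgraph_paths n (x : level G n) : (0 < n)%N ->
  (forall k, borel_set (E' k)) -> measurable (subgraph_paths E' x).
Proof.
move=> n0 mE'; rewrite subgraph_pathsE//.
apply: measurableI; first exact: measurable_edges_upto.
apply: (@borel_set_preimage (prod_topology (fun i : 'I_n.+1 => level G i)) _
  (fun s => s ord_max) [set x]).
  exact: (@proj_continuous _ (fun i : 'I_n.+1 => level G i)).
rewrite -[X in borel_set X]setCK -[X in borel_set X]setTD.
apply: sigma_algebraCD; apply: sub_sigma_algebra.
by rewrite /= openC; exact: closed_level1.
Qed.

Section restriction.
Variable mu : probability (vertex_sequence (level G)) R.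
Hypothesis mE : forall n, borel_set (E' n).
Hypothesis mu_central : central mu.
Hypothesis mu_pos : 0 < mu (subgraph_path_space G E').

Let X := subgraph_path_space G E'.
Let mX : measurable X := measurable_subgraph_path_space subE mE.
Let Q := normalize (mrestr mu mX).
Let c := ((fine (mu X))^-1)%R.

Let QE A : measurable A -> Q A = normalize mu (A `&` X) * c%:E.
Proof.
have mu_fin : mu X \is a fin_num by rewrite fin_num_measure.
move=> _; have -> : normalize mu (A `&` X) = mu (A `&` X).
  exact: (congr1 (fun P => P (A `&` X)) (mnormalize_id mu _)).
rewrite /Q /normalize /= /mnormalize /= /mrestr setTI.
by move: mu_fin; rewrite fin_numE (gt_eqF mu_pos) => /andP[_ /negbTE ->].
Qed.

Let ae_normalize_restr (p : vertex_sequence (level G) -> Prop) :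
  {ae normalize mu, forall v, p v} -> {ae Q, forall v, p v}.
Proof.
move=> [N [mN N0 sub]]; exists N; split=> //.
rewrite QE// [X in X * _](_ : _ = 0) ?mul0e//.
apply/eqP; rewrite eq_le measure_ge0 andbT -N0 le_measure// inE//.
exact: measurableI.
Qed.

(** Positivity and the conditional law are proved together: both come from
    identifying [k t W] with the measure of the subgraph paths. *)
Lemma subgraph_conditional_distribution n : (0 < n)%N ->
  exists kappa : R.-pker (tail (level G) n) ~> (segment (level G) n),
    regular_conditional_distribution Q kappa /\
    {ae Q, forall v : vertex_sequence (level G),
      0 < path_measure G n (v n) (subgraph_paths E' (v n)) /\
      forall B : set (segment (level G) n), measurable B ->
        kappa (tail_from n v) B = subgraph_path_measure E' (v n) B}.
Proof.
move=> n0; have [_ /(_ n n0) [k [kE kae]]] := mu_central.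
pose W := edges_upto E' n.
have mW : measurable W := @measurable_edges_upto _ E' n mE.
have mC := @measurable_edges_from _ E' n mE.
have mseg := @measurable_segment_upto (level G) n.
have mtail := @measurable_tail_from (level G) n.
have c0 : (0 <= c)%R by rewrite invr_ge0 fine_ge0.
have QWE A : measurable A -> Q A = normalize mu (A `&`
    (@segment_upto (level G) n @^-1` W `&`
     @tail_from (level G) n @^-1` edges_from E' n)) * c%:E.
  by rewrite -subgraph_path_spaceE; exact: QE.
pose D : probability (segment (level G) n) R := \d_ point.
exists (knormalize (krestrict k mW) D); split.
  have dis := conditioned_disintegrates mseg mtail mW mC c0 QWE kE D.
  exact: dis.
have kpos : {ae Q, forall v, k (tail_from n v) W != 0}.
  exists (@tail_from (level G) n @^-1` [set t | k t W = 0]); split.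
  - rewrite -[X in measurable X]setTI; apply: mtail => //.
    rewrite -[X in measurable X]setTI.
    exact: (measurable_kernel k W mW measurableT [set 0]).
  - exact: (conditioned_kernel_null mseg mtail mW mC c0 QWE kE).
  - by move=> v /= /negP; rewrite negbK => /eqP.
apply: filterS2 (ae_normalize_restr kae) kpos => v vk vW.
set SP := subgraph_paths E' (v n).
have mSP : measurable SP by exact: measurable_subgraph_paths.
(* The segments in W outside SP do not end at v n, hence form a null set. *)
have kW B : measurable B ->
    k (tail_from n v) (B `&` W) = path_measure G n (v n) (B `&` SP).
  move=> mB; have mBW : measurable (B `&` W) by exact: measurableI.
  rewrite (measureDI _ mBW mSP).
  rewrite [X in X + _](_ : _ = 0).
    rewrite add0e -vk; last exact: measurableI.
    congr (k _ _); rewrite -setIA; congr (_ `&` _); apply/setIidr.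
    by rewrite /SP subgraph_pathsE// => s [].
  transitivity (path_measure G n (v n) (B `&` W `\` SP)).
    by apply: vk; exact: measurableD.
  apply: path_measure_eq0; rewrite -subset0 => s [[[_ sW] nSP] [_ _ sv]].
  by apply: nSP; rewrite /SP subgraph_pathsE.
have kWSP : k (tail_from n v) W = path_measure G n (v n) SP.
  by rewrite -[W in LHS]setTI kW// setTI.
split; first by rewrite -kWSP lt0e vW measure_ge0.
move=> B mB; rewrite /subgraph_path_measure /normalized -kWSP -kW//.
exact: knormalize_krestrictE.
Qed.

End restriction.

End subgraph.

Unset Implicit Arguments.
Theorem theorem2 (R : realType) (G : graded_graph R)
    (E' : forall n : nat, set (level G n * level G n.+1))
    (subE : forall n, E' n `<=` edges G n)
    (mE : forall n, borel_set (E' n))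
    (mu : probability (vertex_sequence (level G)) R)
    (mu_central : central mu)
    (mu_pos : 0 < mu (subgraph_path_space G E')) :
  subgraph_central G E' (mrestr mu (measurable_subgraph_path_space subE mE)).
Proof.
have key := subgraph_conditional_distribution subE mE mu_central mu_pos.
split.
- split.
  + by rewrite /= /mrestr setTI.
  + rewrite /= /mrestr setTI (le_lt_trans (probability_le1 _ _)) ?ltry//.
    exact: measurable_subgraph_path_space.
  + by rewrite /= /mrestr setICl measure0.
- move=> n n0; have [k [_]] := key n n0.
  by apply: filterS => v [].
- move=> n n0; have [k [kE kae]] := key n n0.
  by exists k; split=> //; apply: filterS kae => v [].
Qed.
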